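(* Let $(S,\mathcal{A},\mu)$ be a complete, $\sigma$-finite measure space. If $E$ is an order continuous Köthe function space over $(S,\mathcal{A},\mu)$ which is alternatively convex or smooth (acs) and $X$ is an acs Banach space, then the Köthe-Bochner space $E(X)$ is acs as well.
   Context: All Banach spaces are real. For a Banach space $X$, $X^*$ denotes its dual, $B_X$ its closed unit ball and $S_X$ its unit sphere. A Banach space $X$ is called acs (alternatively convex or smooth) if for every $x,y\in S_X$ with $\|x+y\|=2$ and every $x^*\in S_{X^*}$ with $x^*(x)=1$ we have $x^*(y)=1$ as well. A Köthe function space over a complete, $\sigma$-finite measure space $(S,\mathcal{A},\mu)$ is a Banach space $(E,\|\cdot\|_E)$ of real-valued measurable functions on $S$ modulo equality $\mu$-a.e. such that: (i) $\chi_A\in E$ for every $A\in\mathcal{A}$ with $\mu(A)<\infty$; (ii) every $f\in E$ is $\mu$-integrable over every $A\in\mathcal{A}$ with $\mu(A)<\infty$; (iii) if $g$ is measurable and $f\in E$ with $|g(t)|\le|f(t)|$ $\mu$-a.e., then $g\in E$ and $\|g\|_E\le\|f\|_E$. With the order $f\le g$ iff $f(t)\le g(t)$ $\mu$-a.e., $E$ is a Banach lattice; $E$ is order continuous if every decreasing net in $E$ with infimum zero is norm-convergent to zero. For a Köthe function space $E$ and a Banach space $X$, the Köthe-Bochner space $E(X)$ is the Banach space of all Bochner-measurable functions $f:S\to X$ (modulo equality a.e.) with $\|f(\cdot)\|\in E$, normed by $\|f\|_{E(X)}=\|\,\|f(\cdot)\|\,\|_E$; Bochner-measurable means being the $\mu$-a.e.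 norm limit of a sequence of simple functions. *)

(* Defs.v *)
From HB Require Import structures.
From mathcomp Require Import all_boot all_order all_algebra.
From mathcomp Require Import all_classical all_reals all_analysis.

Set Warnings "-redundant-canonical-projection".
Set Implicit Arguments.
Unset Strict Implicit.
Unset Printing Implicit Defensive.
Import Order.TTheory GRing.Theory Num.Theory.
Import numFieldNormedType.Exports.

Local Open Scope classical_set_scope.
Local Open Scope ring_scope.

Section acs.
Context {R : realType}.

(* For a continuous [phi] the set below is bounded, so that [sup] is the
   operator norm of [phi]. *)
Definition dual_norm (X : normedModType R) (phi : {linear X -> R^o}) : R :=
  sup [set `|phi x : R| | x in [set x : X | `|x| <= 1]].

Definition dual_sphere (X : normedModType R) (phi : {linear X -> R^o}) : Prop :=
  continuous phi /\ dual_norm phi = 1.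

Definition acs (X : normedModType R) : Prop :=
  forall x y : X, `|x| = 1 -> `|y| = 1 -> `|x + y| = 2 ->
  forall phi : {linear X -> R^o}, dual_sphere phi -> phi x = 1 -> phi y = 1.

End acs.

(* A linear space of functions S -> Y with a seminorm that vanishes exactly on
   the functions that are null almost everywhere.  The associated normed space
   [ae_space F] consists of the members of [F] modulo equality a.e.; the value
   of [fs_norm] outside [fs_dom] is irrelevant. *)
Record function_space d (S : measurableType d) (R : realType)
    (mu : {measure set S -> \bar R}) (Y : lmodType R) := FunctionSpace {
  fs_dom : set (S -> Y);
  fs_norm : (S -> Y) -> R;
  fs_dom0 : fs_dom 0;
  fs_domD : forall f g, fs_dom f -> fs_dom g -> fs_dom (f + g);
  fs_domZ : forall a f, fs_dom f -> fs_dom (a *: f);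
  fs_normD : forall f g, fs_dom f -> fs_dom g ->
    fs_norm (f + g) <= fs_norm f + fs_norm g;
  fs_normZ : forall a f, fs_dom f -> fs_norm (a *: f) = `|a| * fs_norm f;
  fs_norm0P : forall f, fs_dom f ->
    fs_norm f = 0 <-> \forall t \ae mu, f t = 0
}.

Section ae_space.
Context d (S : measurableType d) (R : realType).
Context (mu : {measure set S -> \bar R}) (Y : lmodType R).
Variable F : function_space mu Y.

Definition fs_pred : {pred S -> Y} := fun f => `[< fs_dom F f >].

Lemma fs_submod_closed : submod_closed fs_pred.
Proof.
split; first exact/asboolP/fs_dom0.
by move=> a f g /asboolP Ff /asboolP Fg; apply/asboolP/fs_domD => //;
  exact: fs_domZ.
Qed.

HB.instance Definition _ :=
  GRing.isSubmodClosed.Build R (S -> Y) fs_pred fs_submod_closed.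

Definition fs_elt : Type := {f : S -> Y | f \in fs_pred}.
HB.instance Definition _ := SubType.on fs_elt.
HB.instance Definition _ := Choice.on fs_elt.
HB.instance Definition _ := [SubChoice_isSubLmodule of fs_elt by <:].

Lemma fs_eltP (f : fs_elt) : fs_dom F (val f).
Proof. exact/asboolP/(valP f). Qed.

Definition ae_null : {pred fs_elt} :=
  fun f => `[< \forall t \ae mu, val f t = 0 >].

Lemma ae_null_zmod_closed : zmod_closed ae_null.
Proof.
split; first by apply/asboolP; apply: aeW => t; rewrite raddf0.
move=> f g /asboolP f0 /asboolP g0; apply/asboolP.
by apply: filterS2 f0 g0 => t ft gt; rewrite raddfB/= -[LHS]/(_ - _) ft gt subrr.
Qed.

HB.instance Definition _ :=
  GRing.isZmodClosed.Build fs_elt ae_null ae_null_zmod_closed.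

Local Notation quot := (ring_quotient.Quotient.quot ae_null).

Definition ae_space : Type := quot.
HB.instance Definition _ := GRing.Zmodule.on ae_space.

Definition ae_pi (f : fs_elt) : ae_space := \pi_quot%qT f.

Definition ae_rep (u : ae_space) : S -> Y :=
  val (repr (u : quot)).

Definition ae_class (f : S -> Y) (Ff : fs_dom F f) : ae_space :=
  ae_pi (exist _ f (asboolT Ff)).

Lemma ae_rep_dom u : fs_dom F (ae_rep u).
Proof. exact: fs_eltP. Qed.

Lemma ae_pi_eq (f g : fs_elt) :
  ae_pi f = ae_pi g <-> \forall t \ae mu, val f t = val g t.
Proof.
split.
  move=> /eqP; rewrite /ae_pi -ring_quotient.Quotient.idealrBE => /asboolP.
  by apply: filterS => t; rewrite raddfB/= => /eqP; rewrite subr_eq0 => /eqP.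
move=> fg; apply/eqP; rewrite /ae_pi -ring_quotient.Quotient.idealrBE.
apply/asboolP; move: fg; apply: filterS => t fg.
by rewrite raddfB/= -[LHS]/(_ - _) fg subrr.
Qed.

Lemma ae_piD : {morph ae_pi : f g / f + g}.
Proof. exact: raddfD. Qed.

Lemma ae_reprK (u : ae_space) : ae_pi (repr (u : quot)) = u.
Proof. exact: reprK. Qed.

Lemma ae_rep_pi (f : fs_elt) : \forall t \ae mu, ae_rep (ae_pi f) t = val f t.
Proof. by apply/ae_pi_eq; exact: ae_reprK. Qed.

Definition ae_scale (a : R) (u : ae_space) : ae_space :=
  ae_pi (a *: repr (u : quot)).

Lemma ae_piZ a f : ae_pi (a *: f) = ae_scale a (ae_pi f).
Proof.
apply/ae_pi_eq; move: (ae_rep_pi f); apply: filterS => t ft.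
by rewrite !linearZ/= -[LHS]/(a *: val f t) -ft.
Qed.

Let scalerA a b u : ae_scale a (ae_scale b u) = ae_scale (a * b) u.
Proof. by rewrite -[u]ae_reprK -!ae_piZ scalerA. Qed.

Let scale1r : left_id 1 ae_scale.
Proof. by move=> u; rewrite -[u]ae_reprK -ae_piZ scale1r. Qed.

Let scalerDr : right_distributive ae_scale +%R.
Proof.
move=> a u v; rewrite -[u]ae_reprK -[v]ae_reprK -ae_piD -!ae_piZ -ae_piD.
by rewrite scalerDr.
Qed.

Let scalerDl u : {morph ae_scale^~ u : a b / a + b}.
Proof. by move=> a b; rewrite -[u]ae_reprK -!ae_piZ -ae_piD scalerDl. Qed.

HB.instance Definition _ := GRing.Zmodule_isLmodule.Build R ae_space
  scalerA scale1r scalerDr scalerDl.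

Definition ae_norm (u : ae_space) : R := fs_norm F (ae_rep u).

Let fs_normN f : fs_dom F f -> fs_norm F (- f) = fs_norm F f.
Proof.
by move=> Ff; rewrite -scaleN1r fs_normZ// normrN1 mul1r.
Qed.

Lemma fs_norm_ae f g : fs_dom F f -> fs_dom F g ->
  (\forall t \ae mu, f t = g t) -> fs_norm F f = fs_norm F g.
Proof.
have sub u v : fs_dom F u -> fs_dom F v -> fs_dom F (u - v).
  by move=> Fu Fv; rewrite -scaleN1r; apply: fs_domD => //; exact: fs_domZ.
have le u v : fs_dom F u -> fs_dom F v -> (\forall t \ae mu, u t = v t) ->
    fs_norm F u <= fs_norm F v.
  move=> Fu Fv uv; have N0 : fs_norm F (u - v) = 0.
    apply/fs_norm0P; first exact: sub.
    by move: uv; apply: filterS => t uv; rewrite -[LHS]/(u t - v t) uv subrr.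
  rewrite -(subrK v u) (le_trans (fs_normD (sub _ _ Fu Fv) Fv))//.
  by rewrite N0 add0r.
move=> Ff Fg fg; apply/eqP; rewrite eq_le !le//.
by move: fg; apply: filterS.
Qed.

Lemma ae_norm_pi f : ae_norm (ae_pi f) = fs_norm F (val f).
Proof.
apply: fs_norm_ae; [exact: ae_rep_dom|exact: fs_eltP|exact: ae_rep_pi].
Qed.

Let ler_normD u v : ae_norm (u + v) <= ae_norm u + ae_norm v.
Proof.
rewrite -[u]ae_reprK -[v]ae_reprK -ae_piD !ae_norm_pi raddfD/=.
by apply: fs_normD; exact: fs_eltP.
Qed.

Let normrZ a u : ae_norm (a *: u) = `|a| * ae_norm u.
Proof.
rewrite -[u]ae_reprK -[a *: _]ae_piZ !ae_norm_pi linearZ/=.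
by apply: fs_normZ; exact: fs_eltP.
Qed.

Let normr0_eq0 u : ae_norm u = 0 -> u = 0.
Proof.
rewrite -[u]ae_reprK ae_norm_pi => /fs_norm0P => /(_ (fs_eltP _)) u0.
rewrite -[RHS](raddf0 \pi_quot%qT).
by apply/ae_pi_eq; move: u0; apply: filterS => t ->; rewrite raddf0.
Qed.

HB.instance Definition _ := Lmodule_isNormed.Build R ae_space
  ler_normD normrZ normr0_eq0.

End ae_space.

Definition integrable_on_finite d (S : measurableType d) (R : realType)
    (mu : {measure set S -> \bar R}) (f : S -> R) : Prop :=
  forall A, measurable A -> (mu A < +oo)%E -> mu.-integrable A (EFin \o f).

Record kotheSpace d (S : measurableType d) (R : realType)
    (mu : {measure set S -> \bar R}) := KotheSpace {
  kothe_fs :> function_space mu R^o;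
  kothe_measurable : forall f : S -> R,
    fs_dom kothe_fs f -> measurable_fun [set: S] f;
  kothe_indic : forall A : set S,
    measurable A -> (mu A < +oo)%E -> fs_dom kothe_fs (\1_A : S -> R);
  kothe_integrable : forall f : S -> R,
    fs_dom kothe_fs f -> integrable_on_finite mu f;
  kothe_ideal : forall f g : S -> R,
    measurable_fun [set: S] g -> fs_dom kothe_fs f ->
    (\forall t \ae mu, `|g t| <= `|f t|) ->
    fs_dom kothe_fs g /\ fs_norm kothe_fs g <= fs_norm kothe_fs f;
  kothe_complete : forall G : set_system (ae_space kothe_fs),
    ProperFilter G -> cauchy G -> cvg G
}.

Section kothe.
Context d (S : measurableType d) (R : realType).
Context (mu : {measure set S -> \bar R}).

Definition kothe_type (E : kotheSpace mu) : Type := ae_space E.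
HB.instance Definition _ E := NormedModule.on (kothe_type E).
HB.instance Definition _ E :=
  Uniform_isComplete.Build (kothe_type E) (@kothe_complete _ _ _ _ E).

Variable E : kotheSpace mu.

Definition kothe_le (u v : kothe_type E) : Prop :=
  \forall t \ae mu, ae_rep u t <= ae_rep v t :> R.

(* [I] is the index set of a net: nonempty, preordered and directed upwards. *)
Definition directed (I : Type) (leI : I -> I -> Prop) : Prop :=
  [/\ inhabited I, (forall i, leI i i),
      (forall i j k, leI i j -> leI j k -> leI i k) &
      (forall i j, exists k, leI i k /\ leI j k)].

Definition kothe_inf (I : Type) (u : I -> kothe_type E) (w : kothe_type E) :
    Prop :=
  (forall i, kothe_le w (u i)) /\
  (forall v, (forall i, kothe_le v (u i)) -> kothe_le v w).

Definition order_continuous : Prop :=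
  forall (I : Type) (leI : I -> I -> Prop) (u : I -> kothe_type E),
    directed leI ->
    (forall i j, leI i j -> kothe_le (u j) (u i)) ->
    kothe_inf u 0 ->
    forall e : R, 0 < e -> exists i0, forall i, leI i0 i -> `|u i| < e.

End kothe.

Section bochner_measurable.
Context d (S : measurableType d) (R : realType).
Context (mu : {measure set S -> \bar R}) (X : normedModType R).

Definition simple_function (s : S -> X) : Prop :=
  finite_set (range s) /\ forall x, measurable (s @^-1` [set x]).

Definition bochner_measurable (f : S -> X) : Prop :=
  exists s : nat -> S -> X, (forall n, simple_function (s n)) /\
    \forall t \ae mu, s ^~ t @ \oo --> f t.

End bochner_measurable.

Section simple_function_theory.
Context d (S : measurableType d) (R : realType).

Lemma simple_function_cst (X : normedModType R) (x : X) :
  simple_function (fun _ : S => x).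
Proof.
split; first exact: finite_image_cst.
move=> y; rewrite preimage_cst; case: ifPn => _ //; exact: measurable0.
Qed.

Lemma simple_function_preimage (X : normedModType R) (s : S -> X) (B : set X) :
  simple_function s -> measurable (s @^-1` B).
Proof.
move=> [fs ms].
rewrite (_ : _ @^-1` _ = \bigcup_(x in range s `&` B) s @^-1` [set x]).
  by apply: fin_bigcup_measurable => //; exact: finite_setIl.
apply/seteqP; split=> [t Bt|t [x [_ Bx] /= ->]//].
by exists (s t) => //; split => //; exists t.
Qed.

Lemma simple_function_comp2 (X Y Z : normedModType R) (h : X -> Y -> Z)
    (s1 : S -> X) (s2 : S -> Y) :
  simple_function s1 -> simple_function s2 ->
  simple_function (fun t => h (s1 t) (s2 t)).
Proof.
move=> ss1 ss2; have [f1 m1] := ss1; have [f2 m2] := ss2; split.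
  apply: (@sub_finite_set _ _ [set h a b | a in range s1 & b in range s2]).
    by move=> _ [t _ <-]; exists (s1 t); [exists t|exists (s2 t) => //; exists t].
  exact: finite_image2.
move=> z; rewrite (_ : _ @^-1` _ = \bigcup_(x in range s1)
    (s1 @^-1` [set x] `&` s2 @^-1` [set y | h x y = z])).
  apply: fin_bigcup_measurable => // x _; apply: measurableI => //.
  exact: simple_function_preimage.
apply/seteqP; split=> [t /= hz|t [x _ [/= ->]]//].
by exists (s1 t) => //; exists t.
Qed.

End simple_function_theory.

Section bochner_theory.
Context d (S : measurableType d) (R : realType).
Context (mu : {measure set S -> \bar R}) (X : normedModType R).
Hypothesis mu_complete : measure_is_complete mu.

Lemma bochner_measurable0 : bochner_measurable mu (0 : S -> X).
Proof.
exists (fun _ _ => 0); split; first by move=> n; exact: simple_function_cst.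
by apply: aeW => t; exact: cvg_cst.
Qed.

Lemma bochner_measurableD (f g : S -> X) :
  bochner_measurable mu f -> bochner_measurable mu g ->
  bochner_measurable mu (f + g).
Proof.
move=> [s [ss sf]] [r [sr rg]]; exists (fun n t => s n t + r n t); split.
  by move=> n; exact: (simple_function_comp2 +%R).
by apply: filterS2 sf rg => t; exact: cvgD.
Qed.

Lemma bochner_measurableZ (a : R) (f : S -> X) :
  bochner_measurable mu f -> bochner_measurable mu (a *: f).
Proof.
move=> [s [ss sf]]; exists (fun n t => a *: s n t); split.
  by move=> n; exact: (simple_function_comp2 (fun x _ => a *: x) (ss n) (ss n)).
by apply: filterS sf => t; exact: cvgZl_tmp.
Qed.

Lemma bochner_measurable_norm (f : S -> X) :
  bochner_measurable mu f -> measurable_fun [set: S] (fun t => `|f t|).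
Proof.
move=> [s [ss [N [mN N0 subN]]]].
have mCN : measurable (~` N) by exact: measurableC.
rewrite -(setUv N); apply/measurable_funU => //; split.
  by move=> _ B mB; apply: mu_complete; exists N; split.
apply: (measurable_realfun.measurable_fun_cvg (h := fun n t => `|s n t|)).
  move=> n _ B mB; apply: measurableI => //.
  rewrite (_ : _ @^-1` B = s n @^-1` [set x | B `|x|])//.
  exact: simple_function_preimage.
move=> t Nt; apply: cvg_norm; apply: contrapT => nst.
by apply: Nt; exact: subN.
Qed.

End bochner_theory.

Section kothe_bochner.
Context d (S : measurableType d) (R : realType).
Context (mu : {measure set S -> \bar R}).
Hypothesis mu_complete : measure_is_complete mu.
Variables (E : kotheSpace mu) (X : normedModType R).

(* Completeness of [mu] makes [nm f] measurable for Bochner-measurable [f],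
   which is what closure of [kb_dom] under addition rests on. *)
Let nm (f : S -> X) : S -> R^o := fun t => `|f t|.

Definition kb_dom (f : S -> X) : Prop :=
  bochner_measurable mu f /\ fs_dom E (nm f).

Definition kb_norm (f : S -> X) : R := fs_norm E (nm f).

Lemma kb_dom0 : kb_dom 0.
Proof.
split; first exact: bochner_measurable0.
rewrite (_ : nm 0 = 0); first exact: fs_dom0.
by apply/funext => t; rewrite /nm normr0.
Qed.

Let kb_add f g : kb_dom f -> kb_dom g -> fs_dom E (nm (f + g)) /\
  kb_norm (f + g) <= fs_norm E (nm f + nm g).
Proof.
move=> [bf Ef] [bg Eg]; apply: (kothe_ideal (f := nm f + nm g)).
- by apply: (bochner_measurable_norm mu_complete); exact: bochner_measurableD.
- exact: fs_domD.
- apply: aeW => t; rewrite normr_id.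
  by rewrite [leRHS]ger0_norm ?addr_ge0 ?normr_ge0// ler_normD.
Qed.

Lemma kb_domD f g : kb_dom f -> kb_dom g -> kb_dom (f + g).
Proof.
move=> df dg; split; last by case: (kb_add df dg).
by apply: bochner_measurableD; [exact: df.1|exact: dg.1].
Qed.

Let nmZ a f : nm (a *: f) = `|a| *: nm f.
Proof. by apply/funext => t; rewrite /nm -[LHS]/`|a *: f t| normrZ. Qed.

Lemma kb_domZ a f : kb_dom f -> kb_dom (a *: f).
Proof.
move=> [bf Ef]; split; first exact: bochner_measurableZ.
by rewrite nmZ; exact: fs_domZ.
Qed.

Lemma kb_normD f g : kb_dom f -> kb_dom g ->
  kb_norm (f + g) <= kb_norm f + kb_norm g.
Proof.
move=> df dg; have [_ /le_trans] := kb_add df dg; apply.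
by apply: fs_normD; [exact: df.2|exact: dg.2].
Qed.

Lemma kb_normZ a f : kb_dom f -> kb_norm (a *: f) = `|a| * kb_norm f.
Proof. by move=> [_ Ef]; rewrite /kb_norm nmZ fs_normZ// normr_id. Qed.

Lemma kb_norm0P f : kb_dom f -> kb_norm f = 0 <-> \forall t \ae mu, f t = 0.
Proof.
move=> [_ Ef]; split => [/(fs_norm0P Ef)|f0].
  by apply: filterS => t /normr0_eq0.
by apply/(fs_norm0P Ef); move: f0; apply: filterS => t ft; rewrite /nm ft normr0.
Qed.

Definition kothe_bochner_fs : function_space mu X :=
  FunctionSpace kb_dom0 kb_domD kb_domZ kb_normD kb_normZ kb_norm0P.

Definition kothe_bochner : Type := ae_space kothe_bochner_fs.
HB.instance Definition _ := NormedModule.on kothe_bochner.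

End kothe_bochner.

(* Main.v *)
Require Import Defs.
From mathcomp Require Import all_boot all_order all_algebra.
From mathcomp Require Import all_classical all_reals all_analysis.
From HB Require Import structures.
From mathcomp Require Import measurable_realfun lra.

(** The classical argument represents the dual of E(X) by functions with values
    in the dual of X.  The proof below uses functionals on E and on X only.

    Let f, g be unit vectors of E(X) with ||f + g|| = 2, let phi be a functional
    of norm one with phi(f) = 1, and write u = |f|, v = |g|, w = |f + g| for the
    pointwise norms, which are elements of E.  Multiplying the direction field
    f/|f| by a scalar function k embeds E into E(X), and
      psi(k) = phi(k f/|f|)
    is a functional of norm one on E with psi(u) = 1 ([radial_functional]).
    Since w <= u + v we have ||u + v|| = 2, and ||f + (f + g)|| = 3 gives
    ||u + w|| = 3; as E is acs, psi(v) = 1 and psi(w) = 2.  The defect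
    r = u + v - w is nonnegative and psi(r) = 0.  A functional that norms u + v
    is positive on the multiples of the order interval [0, u + v], and order
    continuity then shows that psi ignores the set where r > 0
    ([norming_vanish]).  So, with G the set where r = 0 and f <> 0, the function
    h1 = 1_G v f/|f| satisfies phi(h1) = psi(v) = 1.  It remains to see that phi
    vanishes on g - h1, which is treated separately on G and off G.

    Off G: h1 +- 1_(~G) g has pointwise norm at most v, hence norm at most 1, so
    that phi(h1) = 1 forces phi(1_(~G) g) = 0.

    On G: |f(t) + g(t)| = |f(t)| + |g(t)| and f(t) <> 0, so every functional that
    norms f(t) also norms g(t), because X is acs; it vanishes therefore at
    z(t) = g(t) - (|g(t)|/|f(t)|) f(t).  By the Hahn-Banach theorem the
    derivative of the norm of X at f(t) in the directions z(t) and -z(t) is 0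
    ([norm_slope_cvg]): the functions |z + n f| - n |f| decrease to 0 pointwise.
    By order continuity they tend to 0 in E, and since phi norms f, this bounds
    phi(z) and phi(-z) above by 0 ([vanishing_perturbation]). *)

Set Implicit Arguments.
Unset Strict Implicit.
Unset Printing Implicit Defensive.
Import Order.TTheory GRing.Theory Num.Theory.
Import numFieldNormedType.Exports.

Local Open Scope classical_set_scope.
Local Open Scope ring_scope.

(** * Sublinear functionals and the Hahn-Banach theorem *)

Section hahn_banach.
Context {R : realType} {V : lmodType R}.
Implicit Types (p q : V -> R) (x y z : V).

Definition sublinear p : Prop :=
  (forall x y, p (x + y) <= p x + p y) /\
  (forall a x, 0 <= a -> p (a *: x) <= a * p x).

Lemma sublinear0 p : sublinear p -> p 0 = 0.
Proof.
move=> [pD pZ]; apply/eqP; rewrite eq_le.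
have := pZ 0 0 (lexx 0); rewrite scale0r mul0r => ->/=.
by have := pD 0 0; rewrite addr0 lerDl.
Qed.

Lemma sublinearZ p a x : sublinear p -> 0 <= a -> p (a *: x) = a * p x.
Proof.
move=> sp; rewrite le_eqVlt => /predU1P[<-|a0].
  by rewrite scale0r mul0r sublinear0.
have [_ pZ] := sp; apply/le_anti/andP; split; first exact: pZ (ltW a0).
rewrite -ler_pdivlMl//; have := pZ a^-1 (a *: x).
by rewrite scalerK ?lt0r_neq0// invr_ge0; apply; exact: ltW.
Qed.

Lemma sublinear_opp p x : sublinear p -> - p (- x) <= p x.
Proof.
move=> sp; have [pD _] := sp.
by have := pD x (- x); rewrite subrr sublinear0// addrC -subr_ge0 => ?; lra.
Qed.


(** With s = 1/t the infimum ranges over the slopes (p (z + t y) - p z) / t, which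
    decrease with t: this is the one-sided derivative of p at z in the direction
    y, in a form that needs no limit. *)
Definition dir_deriv p z y : R :=
  inf [set p (y + s *: z) - s * p z | s in [set s | 0 <= s]].

Lemma dir_deriv_lb p z y s : sublinear p -> 0 <= s ->
  - p (- y) <= p (y + s *: z) - s * p z.
Proof.
move=> sp s0; have := sp.1 (y + s *: z) (- y).
by rewrite addrAC subrr add0r sublinearZ// => ?; lra.
Qed.

Lemma dir_deriv_le p z y s : sublinear p -> 0 <= s ->
  dir_deriv p z y <= p (y + s *: z) - s * p z.
Proof.
move=> sp s0; apply: ge_inf; last by exists s.
by exists (- p (- y)) => _ [a a0 <-]; exact: dir_deriv_lb.
Qed.

Lemma le_dir_deriv p z y c :
  (forall s, 0 <= s -> c <= p (y + s *: z) - s * p z) -> c <= dir_deriv p z y.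
Proof.
move=> h; apply: lb_le_inf; last by move=> _ [s s0 <-]; exact: h.
by exists (p (y + 0 *: z) - 0 * p z); exists 0 => /=.
Qed.

Lemma dir_deriv_le_self p z y : sublinear p -> dir_deriv p z y <= p y.
Proof.
by move=> sp; have := dir_deriv_le z y sp (lexx 0);
  rewrite scale0r addr0 mul0r subr0.
Qed.

Lemma dir_deriv_opp p z : sublinear p -> dir_deriv p z (- z) <= - p z.
Proof.
move=> sp; have := dir_deriv_le z (- z) sp ler01.
by rewrite scale1r addNr mul1r sublinear0// sub0r.
Qed.

(** The parameters add up: slopes at s for x and at t for y bound the slope at
    s + t for x + y. *)
Lemma dir_deriv_sublinear p z : sublinear p -> sublinear (dir_deriv p z).
Proof.
move=> sp; split=> [x y|a x].
  rewrite -lerBlDr; apply: le_dir_deriv => s s0.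
  rewrite lerBlDr -lerBlDl; apply: le_dir_deriv => t t0.
  rewrite lerBlDl (le_trans (dir_deriv_le _ _ sp (addr_ge0 s0 t0)))//.
  have := sp.1 (x + s *: z) (y + t *: z).
  by rewrite addrACA -scalerDl => ?; lra.
rewrite le_eqVlt => /predU1P[<-|a0].
  by rewrite scale0r mul0r (le_trans (dir_deriv_le_self _ _ sp)) ?sublinear0.
rewrite -ler_pdivrMl//; apply: le_dir_deriv => s s0.
rewrite ler_pdivrMl// (le_trans (dir_deriv_le z _ sp (mulr_ge0 (ltW a0) s0)))//.
by rewrite -scalerA -scalerDr (sublinearZ _ sp (ltW a0)) mulrBr mulrA.
Qed.

(** Zorn's lemma: the pointwise infimum of a chain is finite, because
    - p (- x) <= q x for all sublinear q <= p, and it is again sublinear, because of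
    two members of a chain one lies below the other. *)
Lemma minimal_sublinear p : sublinear p ->
  exists q, [/\ sublinear q, forall x, q x <= p x &
    forall q', sublinear q' -> (forall x, q' x <= q x) -> q' = q].
Proof.
move=> sp.
pose T := {q : V -> R | sublinear q /\ forall x, q x <= p x}.
pose leT (q q' : T) := `[< forall x, sval q' x <= sval q x >].
have [|||A totA|[q [sq qp]] minq] := @Zorn T leT.
- by move=> q; apply/asboolP.
- move=> q q' q'' /asboolP h /asboolP h'; apply/asboolP => x.
  exact: le_trans (h' x) (h x).
- move=> [q hq] [q' hq'] /asboolP /= h /asboolP /= h'; apply: eq_exist.
  by apply/funext => x; apply/eqP; rewrite eq_le h h'.
- have [[q0 Aq0]|A0] := pselect (exists q : T, A q); last first.
    have pp : sublinear p /\ forall x, p x <= p x by split.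
    by exists (exist _ p pp) => q Aq; case: A0; exists q.
  pose m x := inf [set sval q x | q in A].
  have lem (q : T) x : A q -> m x <= sval q x.
    move=> Aq; apply: ge_inf; last by exists q.
    exists (- p (- x)) => _ [q' _ <-].
    rewrite (le_trans _ (sublinear_opp x (svalP q').1))// lerN2.
    exact: (svalP q').2.
  have mge x c : (forall q : T, A q -> c <= sval q x) -> c <= m x.
    move=> h; apply: lb_le_inf; first by exists (sval q0 x), q0.
    by move=> _ [q' Aq' <-]; exact: h.
  have sm : sublinear m.
    split=> [x y|a x].
      rewrite -lerBlDr; apply: (mge) => q Aq.
      rewrite lerBlDr -lerBlDl; apply: (mge) => q' Aq'; rewrite lerBlDl.
      have [/asboolP qq'|/asboolP qq'] := totA _ _ Aq Aq'.
        by rewrite (le_trans (lem _ _ Aq'))//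
          (le_trans ((svalP q').1.1 _ _))// lerD2r.
      by rewrite (le_trans (lem _ _ Aq))//
        (le_trans ((svalP q).1.1 _ _))// lerD2l.
    rewrite le_eqVlt => /predU1P[<-|a0].
      rewrite scale0r mul0r (le_trans (lem _ _ Aq0))//.
      by rewrite sublinear0//; exact: (svalP q0).1.
    rewrite -ler_pdivrMl//; apply: (mge) => q Aq.
    rewrite ler_pdivrMl// (le_trans (lem _ _ Aq))//.
    by apply: (svalP q).1.2; exact: ltW.
  have mp x : m x <= p x.
    by rewrite (le_trans (lem _ _ Aq0))//; exact: (svalP q0).2.
  exists (exist _ m (conj sm mp)) => q Aq; apply/asboolP => x; exact: lem.
- exists q; split => // q' sq' q'q.
  have q'p x : q' x <= p x by exact: le_trans (q'q x) (qp x).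
  have := minq (exist _ q' (conj sq' q'p)).
  by move=> /(_ (asboolT q'q))/(congr1 sval).
Qed.

(** Hahn-Banach: a minimal sublinear q is linear, for minimality makes q equal to
    its own directional derivative at z, which gives q (- z) <= - q z. *)
Theorem sublinear_dominates_linear p : sublinear p ->
  exists phi : {linear V -> R^o}, forall x, phi x <= p x.
Proof.
move=> /minimal_sublinear[q [sq qp minq]].
have qN x : q (- x) = - q x.
  apply/le_anti; rewrite -[in X in _ && X](opprK (q (- x))) lerN2.
  have -> : q (- x) <= - q x.
    rewrite -{1}(minq _ (dir_deriv_sublinear x sq)) ?dir_deriv_opp// => y.
    exact: dir_deriv_le_self.
  by rewrite sublinear_opp.
have qD x y : q (x + y) = q x + q y.
  apply/le_anti; rewrite sq.1/= -lerN2 opprD -!qN opprD; exact: sq.1.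
have qZ a x : q (a *: x) = a * q x.
  have [a0|/ltW a0] := leP 0 a; first exact: sublinearZ.
  have := @sublinearZ q (- a) x sq; rewrite oppr_ge0 => /(_ a0).
  by rewrite scaleNr qN mulNr => /oppr_inj.
have lq : linear (q : V -> R^o) by move=> a x y; rewrite qD qZ.
pose Lq := GRing.isLinear.Build R V R^o *:%R q lq.
pose phi : {linear V -> R^o} := HB.pack q Lq.
by exists phi.
Qed.

(** A linear functional below the directional derivative of p at z touches p
    at z. *)
Corollary sublinear_tangent p z : sublinear p ->
  exists2 phi : {linear V -> R^o}, (forall x, phi x <= p x) & phi z = p z.
Proof.
move=> sp.
have [phi phile] := sublinear_dominates_linear (dir_deriv_sublinear z sp).
exists phi => [x|]; first exact: le_trans (phile x) (dir_deriv_le_self _ _ sp).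
apply/le_anti; rewrite (le_trans (phile z) (dir_deriv_le_self _ _ sp))/=.
by rewrite -lerN2 -linearN (le_trans (phile _))// dir_deriv_opp.
Qed.

End hahn_banach.

(** * Norming functionals and the derivative of the norm *)

Section aligned_vectors.
Context {R : realType} {X : normedModType R}.
Implicit Types (x y z : X) (phi : {linear X -> R^o}).

Lemma aligned_conic_ge x y a b : `|x + y| = `|x| + `|y| -> 0 <= b -> b <= a ->
  a * `|x| + b * `|y| <= `|a *: x + b *: y|.
Proof.
move=> xy b0 ba; have a0 := le_trans b0 ba.
have -> : a *: x + b *: y = a *: (x + y) - (a - b) *: y.
  by rewrite scalerDr -addrA -scalerBl (_ : a - (a - b) = b)//; lra.
apply: le_trans (lerB_dist _ _).
by rewrite !normrZ xy !ger0_norm// ?subr_ge0//; lra.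
Qed.

(** Norm additivity passes from x, y to the whole cone that they span; the lower
    bound subtracts a multiple of y from a multiple of x + y. *)
Lemma aligned_conic x y a b : `|x + y| = `|x| + `|y| -> 0 <= a -> 0 <= b ->
  `|a *: x + b *: y| = a * `|x| + b * `|y|.
Proof.
move=> xy a0 b0; apply/le_anti/andP; split.
  by rewrite (le_trans (ler_normD _ _))// !normrZ !ger0_norm.
have [ba|/ltW ab] := leP b a; first exact: aligned_conic_ge.
rewrite addrC [X in _ <= `|X|]addrC; apply: aligned_conic_ge => //.
by rewrite addrC xy addrC.
Qed.

(** For linear functionals the one-sided bound is the same as operator norm at
    most 1. *)
Definition contractive phi : Prop := forall x, phi x <= `|x|.

Lemma contractive_abs phi x : contractive phi -> `|phi x| <= `|x|.
Proof.
by move=> phi1; rewrite ler_norml phi1 lerNl -linearN -normrN phi1.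
Qed.

Lemma dual_sphere_contractive phi : dual_sphere phi -> contractive phi.
Proof.
move=> [/linear_bounded_continuous/linear_boundedP bphi phi1] x.
have [->|x0] := eqVneq x 0; first by rewrite linear0 normr0.
have [M [M0 phiM]] : exists M, 0 <= M /\ forall y, `|phi y| <= M * `|y|.
  by move/pinfty_ex_gt0 : bphi => [M M0 h]; exists M; rewrite ltW.
have nx : 0 < `|x| by rewrite normr_gt0.
have : `|phi (`|x|^-1 *: x) : R| <= dual_norm phi.
  apply: ub_le_sup; last first.
    by exists (`|x|^-1 *: x) => //=; rewrite normrZ normfV normr_id mulVf ?gt_eqF.
  exists M => _ [y /= y1 <-]; rewrite (le_trans (phiM y))//.
  by rewrite ler_piMr.
rewrite phi1 linearZ/= normrM normfV normr_id ler_pdivrMl// mulr1.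
exact/le_trans/ler_norm.
Qed.

Lemma contractive_dual_sphere phi x : contractive phi ->
  `|x| = 1 -> phi x = 1 -> dual_sphere phi.
Proof.
move=> phi1 x1 phix; split.
  apply/linear_bounded_continuous/linear_boundedP.
  near=> r => y; rewrite (le_trans (contractive_abs y phi1))//.
  by rewrite ler_peMl//; near: r; exact: nbhs_pinfty_ge.
apply/le_anti/andP; split.
  apply: ge_sup; first by exists `|phi x : R|, x => //=; rewrite x1.
  by move=> _ [y /= y1 <-]; exact: le_trans (contractive_abs y phi1) y1.
apply: ub_le_sup; last by exists x; rewrite /= ?x1 // phix normr1.
by exists 1 => _ [y /= y1 <-]; exact: le_trans (contractive_abs y phi1) y1.
Unshelve. all: by end_near. Qed.

(** The acs property without the normalisation of the vectors: normalising
    x and y keeps them aligned by [aligned_conic]. *)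
Lemma acs_aligned x y phi : acs X -> `|x + y| = `|x| + `|y| -> x != 0 ->
  contractive phi -> phi x = `|x| -> phi y = `|y|.
Proof.
move=> acsX xy x0 phi1 phix.
have [->|y0] := eqVneq y 0; first by rewrite linear0 normr0.
have unit z : z != 0 -> `| `|z|^-1 *: z| = 1.
  by move=> z0; rewrite normrZ normfV normr_id mulVf ?normr_eq0.
have phix' : phi (`|x|^-1 *: x) = 1.
  by rewrite linearZ/= phix [LHS]mulVf ?normr_eq0.
have : phi (`|y|^-1 *: y) = 1.
  apply: (acsX (`|x|^-1 *: x)); rewrite ?unit//.
    by rewrite aligned_conic// ?invr_ge0// !mulVf ?normr_eq0.
  exact: contractive_dual_sphere phi1 (unit _ x0) phix'.
rewrite linearZ/= => /(congr1 ( *%R `|y|)).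
by rewrite mulr1 mulrA mulfV ?normr_eq0// mul1r.
Qed.

Lemma norm_sublinear : sublinear (fun x : X => `|x|).
Proof.
split; first exact: ler_normD.
by move=> a x a0; rewrite normrZ ger0_norm.
Qed.

Lemma norm_slope_antitone x z (n : nat) :
  `|z + n.+1%:R *: x| - n.+1%:R * `|x| <= `|z + n%:R *: x| - n%:R * `|x|.
Proof.
rewrite -addn1 natrD scalerDl scale1r addrA mulrDl mul1r.
by have := ler_normD (z + n%:R *: x) x => ?; lra.
Qed.

(** The limit of the decreasing sequence is the derivative of the norm at x in the
    direction z.  By Hahn-Banach this derivative is the value at z of some
    functional that norms x. *)
Lemma norm_slope_cvg x z :
  (forall phi, contractive phi -> phi x = `|x| -> phi z = 0) ->
  (forall n : nat, 0 <= `|z + n%:R *: x| - n%:R * `|x|) /\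
  (fun n : nat => `|z + n%:R *: x| - n%:R * `|x|) @ \oo --> (0 : R).
Proof.
move=> phiz; pose p := dir_deriv (fun y : X => `|y|) x.
have p0 : p z = 0.
  rewrite {}/p.
  have [phi phip <-] :=
    sublinear_tangent z (dir_deriv_sublinear x norm_sublinear).
  have phi1 : contractive phi.
    by move=> y; exact: le_trans (phip y) (dir_deriv_le_self _ _ norm_sublinear).
  apply: phiz => //; apply/le_anti; rewrite phi1/= -lerN2 -linearN.
  exact: le_trans (phip _) (dir_deriv_opp _ norm_sublinear).
have ge0 (n : nat) : 0 <= `|z + n%:R *: x| - n%:R * `|x|.
  by rewrite -p0; apply: (dir_deriv_le _ _ norm_sublinear).
split=> //; apply/cvgrPdist_lt => e e0.
have [s [s0 sle]] : exists s : R, 0 <= s /\ `|z + s *: x| - s * `|x| < e.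
  apply: contrapT => h; suff : e <= p z by rewrite p0 leNgt e0.
  by apply: le_dir_deriv => s s0; rewrite leNgt; apply/negP => se; apply: h; exists s.
near=> n; rewrite sub0r normrN ger0_norm//; apply: le_lt_trans sle.
have sn : s <= n%:R by near: n; exact: nbhs_infty_ger.
have := ler_normD (z + s *: x) ((n%:R - s) *: x).
rewrite -addrA -scalerDl [s + _]addrC subrK normrZ ger0_norm ?subr_ge0// mulrBl.
by move=> ?; lra.
Unshelve. all: by end_near. Qed.

(** The scalar c serves to treat the directions z and - z at once. *)
Lemma acs_norm_slope_cvg x y (c : R) : acs X -> `|x + y| = `|x| + `|y| ->
  x != 0 -> let z := c *: (y - (`|y| / `|x|) *: x) in
  (forall n : nat, 0 <= `|z + n%:R *: x| - n%:R * `|x|) /\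
  (fun n : nat => `|z + n%:R *: x| - n%:R * `|x|) @ \oo --> (0 : R).
Proof.
move=> acsX xy x0 z; apply: norm_slope_cvg => phi phi1 phix.
rewrite linearZ/= linearB/= linearZ/= phix (acs_aligned acsX xy x0 phi1 phix).
by rewrite -[X in _ - X]/(`|y| / `|x| * `|x|) divfK ?normr_eq0// subrr scaler0.
Qed.

End aligned_vectors.

(** * Classes of functions, order continuity and measurability *)

Section class_of_function.
Context d (S : measurableType d) (R : realType).
Context (mu : {measure set S -> \bar R}) (Y : lmodType R).
Variable F : function_space mu Y.
Implicit Types f g : S -> Y.

(** A total version of [ae_class], so that equations between classes need no
    domain proofs inside terms. *)
Definition ae_of f : ae_space F :=
  if pselect (fs_dom F f) is left Ff then ae_class Ff else 0.

Lemma ae_ofE f (Ff : fs_dom F f) : ae_of f = ae_class Ff.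
Proof.
by rewrite /ae_of; case: pselect => // Ff'; rewrite (Prop_irrelevance Ff' Ff).
Qed.

Lemma ae_rep_of f : fs_dom F f -> \forall t \ae mu, ae_rep (ae_of f) t = f t.
Proof. by move=> Ff; rewrite (ae_ofE Ff); exact: ae_rep_pi. Qed.

Lemma ae_of_eq f g : fs_dom F f -> fs_dom F g ->
  (\forall t \ae mu, f t = g t) -> ae_of f = ae_of g.
Proof. by move=> Ff Fg fg; rewrite (ae_ofE Ff) (ae_ofE Fg); exact/ae_pi_eq. Qed.

Lemma ae_of_rep u : ae_of (ae_rep u) = u.
Proof.
rewrite (ae_ofE (ae_rep_dom u)) -[RHS]ae_reprK; apply/ae_pi_eq; exact: aeW.
Qed.

Lemma ae_ofD f g : fs_dom F f -> fs_dom F g -> ae_of (f + g) = ae_of f + ae_of g.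
Proof.
move=> Ff Fg; rewrite (ae_ofE Ff) (ae_ofE Fg) (ae_ofE (fs_domD Ff Fg)) -ae_piD.
by apply/ae_pi_eq; apply: aeW => t; rewrite raddfD.
Qed.

Lemma ae_ofZ (a : R) f : fs_dom F f -> ae_of (a *: f) = a *: ae_of f.
Proof.
move=> Ff; rewrite (ae_ofE Ff) (ae_ofE (fs_domZ a Ff)) -[RHS]ae_piZ.
by apply/ae_pi_eq; apply: aeW => t; rewrite linearZ.
Qed.

Lemma fs_domB f g : fs_dom F f -> fs_dom F g -> fs_dom F (f - g).
Proof.
by move=> Ff Fg; rewrite -scaleN1r; apply: fs_domD => //; exact: fs_domZ.
Qed.

Lemma ae_ofB f g : fs_dom F f -> fs_dom F g -> ae_of (f - g) = ae_of f - ae_of g.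
Proof.
move=> Ff Fg; have FNg := fs_domZ (-1) Fg.
by rewrite -[in LHS]scaleN1r ae_ofD// ae_ofZ// scaleN1r.
Qed.

Lemma ae_norm_of f : fs_dom F f -> `|ae_of f| = fs_norm F f.
Proof. by move=> Ff; rewrite (ae_ofE Ff) -[LHS]/(ae_norm _) ae_norm_pi. Qed.

Lemma ae_rep0 : \forall t \ae mu, ae_rep (0 : ae_space F) t = 0.
Proof.
have F0 := fs_dom0 F.
have : (0 : ae_space F) = ae_of 0.
  by rewrite -(scale0r (0 : S -> Y)) ae_ofZ// scale0r.
by move: (0 : ae_space F) => w ->; exact: ae_rep_of.
Qed.

Lemma ae_repD u v :
  \forall t \ae mu, ae_rep (u + v : ae_space F) t = ae_rep u t + ae_rep v t.
Proof.
have : u + v = ae_of (ae_rep u + ae_rep v).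
  by rewrite ae_ofD ?ae_of_rep//; exact: ae_rep_dom.
move: (u + v) => w ->.
by apply: ae_rep_of; apply: fs_domD; exact: ae_rep_dom.
Qed.

Lemma ae_repZ (a : R) u :
  \forall t \ae mu, ae_rep (a *: u : ae_space F) t = a *: ae_rep u t.
Proof.
have : a *: u = ae_of (a *: ae_rep u).
  by rewrite ae_ofZ ?ae_of_rep//; exact: ae_rep_dom.
move: (a *: u) => w ->.
by apply: ae_rep_of; apply: fs_domZ; exact: ae_rep_dom.
Qed.

End class_of_function.

(** The classes of the k n form a decreasing net over nat.  A lower bound of all of
    them lies below every k n outside one null set, by countability, and hence
    below their pointwise limit. *)
Lemma order_continuous_seq d (S : measurableType d) (R : realType)
    (mu : {measure set S -> \bar R}) (E : kotheSpace mu) (k : nat -> S -> R) :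
  order_continuous E -> (forall n, fs_dom E (k n)) ->
  (forall n t, k n.+1 t <= k n t) -> (forall n t, 0 <= k n t) ->
  (forall t, k ^~ t @ \oo --> (0 : R)) ->
  forall e : R, 0 < e -> exists n, fs_norm E (k n) < e.
Proof.
move=> oc Ek decr k0 kcvg e e0.
pose u n : kothe_type E := ae_of E (k n).
have urep n : \forall t \ae mu, ae_rep (u n) t = k n t by exact: ae_rep_of.
have [|||n0 h] := oc nat (fun i j => (i <= j)%N) u _ _ _ e e0.
- split=> //; [exact: (inhabits 0%N)|by move=> i j l; exact: leq_trans|].
  by move=> i j; exists (maxn i j); rewrite leq_maxl leq_maxr.
- move=> i j ij; apply: filterS2 (urep i) (urep j) => t -> ->.
  by have /nonincreasing_seqP := (fun n => decr n t); exact.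
- split=> [i|v vk].
    by apply: filterS2 (urep i) (ae_rep0 E) => t -> ->; exact: k0.
  apply: filterS3 (ae_foralln vk) (ae_foralln urep) (ae_rep0 E) => t vt kt ->.
  apply: cvgr_to_ge (kcvg t) _; apply: nearW => n.
  by rewrite -kt; exact: vt.
by exists n0; have := h n0 (leqnn _); rewrite [`|_|]ae_norm_of.
Qed.

Section bochner_scaling.
Import HBSimple.
Context d (S : measurableType d) (R : realType).
Context (mu : {measure set S -> \bar R}).

Lemma measurable_bochner (a : S -> R) : measurable_fun [set: S] a ->
  bochner_measurable mu (a : S -> R^o).
Proof.
move=> ma.
have [s scvg] := approximation_sfun measurableT ((measurable_EFinP _ _).2 ma).
exists (fun n t => s n t); split => [n|].
  split; first exact: fimfunP.
  by move=> x; exact: measurable_sfunP.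
by apply: aeW => t; exact: (fine_cvg (scvg t I)).
Qed.

Lemma bochner_measurable_scale (X : normedModType R) (a : S -> R) (f : S -> X) :
  measurable_fun [set: S] a -> bochner_measurable mu f ->
  bochner_measurable mu (fun t => a t *: f t).
Proof.
move=> /measurable_bochner[r [sr ra]] [s [ss sf]].
exists (fun n t => (r n t : R) *: s n t); split.
  by move=> n; exact: (simple_function_comp2 (fun (b : R^o) x => (b : R) *: x)).
by apply: filterS2 ra sf => t; exact: cvgZ.
Qed.

(** For nonnegative reals the inverse, with 0^-1 = 0, is the power -1. *)
Lemma measurable_fun_inv_ge0 (a : S -> R) : measurable_fun [set: S] a ->
  (forall t, 0 <= a t) -> measurable_fun [set: S] (fun t => (a t)^-1).
Proof.
move=> ma a0; under eq_fun do rewrite -powR_inv1//.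
exact: (measurableT_comp (measurable_powR _)).
Qed.

End bochner_scaling.

(** * Norming functionals on a Koethe space *)

Section kothe_functionals.
Context d (S : measurableType d) (R : realType).
Context (mu : {measure set S -> \bar R}) (E : kotheSpace mu).
Implicit Types (k r s v : S -> R^o) (psi : {linear kothe_type E -> R^o}).

Lemma kothe_solid h k : measurable_fun [set: S] (h : S -> R) -> fs_dom E k ->
  (forall t, `|h t| <= `|k t|) -> fs_dom E h /\ fs_norm E h <= fs_norm E k.
Proof. by move=> mh Ek hk; apply: kothe_ideal => //; exact: aeW. Qed.

(** If psi were negative at k, then it would exceed the norm of c s at c s - k,
    although c s - k lies between 0 and c s. *)
Lemma norming_ge0 psi s k (c : R) : contractive psi ->
  fs_dom E s -> fs_dom E k -> psi (ae_of E s) = fs_norm E s -> 0 <= c ->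
  (forall t, 0 <= k t <= c * s t) -> 0 <= psi (ae_of E k).
Proof.
move=> psi1 Es Ek psis c0 kcs.
have Ecs := fs_domZ c Es.
have Ecsk := fs_domB Ecs Ek.
have [_ le1] : fs_dom E (c *: s - k) /\ fs_norm E (c *: s - k) <= fs_norm E (c *: s).
  apply: kothe_solid => //; first exact: (kothe_measurable Ecsk).
  move=> t; have /andP[k0 kc] := kcs t.
  rewrite -[X in `|X| <= _]/(c * s t - k t) -[X in _ <= `|X|]/(c * s t).
  by rewrite !ger0_norm ?subr_ge0 ?(le_trans k0)// gerBl.
have := le_trans (psi1 (ae_of E (c *: s - k))).
rewrite [`|_|]ae_norm_of// => /(_ _ le1).
rewrite ae_ofB// ae_ofZ// linearB linearZ/= psis fs_normZ// ger0_norm//.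
by rewrite gerBl.
Qed.

(** By [norming_ge0], psi lies between 0 and n psi (r) = 0 at the truncations
    min (v, n r).  These increase to v on the set where r > 0 and are 0 elsewhere,
    so that by order continuity psi does not see v on the set where r > 0. *)
Lemma norming_vanish psi s r v : order_continuous E -> contractive psi ->
  fs_dom E s -> fs_dom E r -> fs_dom E v ->
  psi (ae_of E s) = fs_norm E s -> psi (ae_of E r) = 0 ->
  (forall t, 0 <= r t <= s t) -> (forall t, 0 <= v t) ->
  let v0 : S -> R^o := fun t => \1_[set t | r t = 0] t * v t in
  fs_dom E v0 /\ psi (ae_of E v0) = psi (ae_of E v).
Proof.
move=> oc psi1 Es Er Ev psis psir rs v_ge0 v0.
have mr : measurable_fun [set: S] (r : S -> R) := kothe_measurable Er.
have mv : measurable_fun [set: S] (v : S -> R) := kothe_measurable Ev.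
have mZ : measurable [set t | r t = 0].
  by rewrite -[X in measurable X]setTI; exact: (mr measurableT [set 0 : R]).
have mv0 : measurable_fun [set: S] (v0 : S -> R).
  by apply: measurable_funM => //; exact: measurable_indic.
have [Ev0 _] : fs_dom E v0 /\ fs_norm E v0 <= fs_norm E v.
  apply: kothe_solid => // t; rewrite /v0 normrM ler_piMl// indicE.
  by case: (_ \in _); rewrite ?normr1 ?normr0.
split=> //.
pose m (n : nat) : S -> R^o := fun t => Num.min (v t : R) (n%:R * r t).
have m_ge0 n t : 0 <= m n t.
  by have /andP[r0 _] := rs t; rewrite /m le_min v_ge0 mulr_ge0.
have mm n : measurable_fun [set: S] (m n : S -> R).
  by apply: measurable_minr => //; exact: measurable_funM.
have [Em psim] : (forall n, fs_dom E (m n)) /\ (forall n, psi (ae_of E (m n)) = 0).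
  suff h n : fs_dom E (m n) /\ psi (ae_of E (m n)) = 0.
    by split=> n; have [] := h n.
  have [Em _] : fs_dom E (m n) /\ fs_norm E (m n) <= fs_norm E v.
    by apply: kothe_solid => // t; rewrite !ger0_norm// ge_min lexx.
  split=> //.
  have Enr := fs_domZ n%:R Er.
  apply/le_anti/andP; split; last first.
    apply: (norming_ge0 (c := n%:R) psi1 Es Em psis) => // t.
    have /andP[r0 r1] := rs t; rewrite m_ge0/= ge_min; apply/orP; right.
    exact: ler_wpM2l.
  have := norming_ge0 (c := n%:R) psi1 Es (fs_domB Enr Em) psis (ler0n _ _).
  rewrite ae_ofB// ae_ofZ// linearB linearZ/= psir scaler0 sub0r oppr_ge0.
  apply => t; rewrite -[X in 0 <= X <= _]/(n%:R * r t - m n t) subr_ge0.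
  have /andP[r0 r1] := rs t.
  rewrite ge_min lexx orbT/= lerBlDr.
  by rewrite (le_trans (ler_wpM2l (ler0n _ _) r1))// lerDl.
(* q n is what the n-th truncation leaves of v on the set where r > 0. *)
pose q (n : nat) : S -> R^o := v - v0 - m n.
have Evv0 := fs_domB Ev Ev0.
have Eq n : fs_dom E (q n) by exact: fs_domB.
have qE n t : q n t = v t - v0 t - m n t by [].
have psiq n : psi (ae_of E (q n)) = psi (ae_of E v) - psi (ae_of E v0).
  by rewrite /q !ae_ofB// !linearB/= psim subr0.
have qcase t : (r t = 0 /\ forall n, q n t = 0) \/
    (0 < r t /\ forall n, q n t = v t - m n t).
  have /andP[r0 _] := rs t.
  have [rt|rt] := eqVneq (r t) 0; [left|right]; split=> //.
  - move=> n; rewrite qE /v0 indicE mem_set// mul1r subrr sub0r /m rt mulr0.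
    by rewrite min_r// oppr0.
  - by rewrite lt_neqAle eq_sym rt.
  - move=> n; rewrite qE /v0 indicE memNset ?mul0r ?subr0//=.
    exact/eqP.
have q_small : forall e : R, 0 < e -> exists n, fs_norm E (q n) < e.
  apply: order_continuous_seq => //.
  - move=> n t; case: (qcase t) => -[rt qt]; rewrite !qt// lerD2l lerN2.
    rewrite /m le_min !ge_min lexx/=; apply/orP; right.
    by rewrite ler_wpM2r ?ler_nat// ltW.
  - move=> n t; case: (qcase t) => -[rt qt]; rewrite !qt// subr_ge0.
    by rewrite ge_min lexx.
  - move=> t; case: (qcase t) => -[rt qt].
      by under eq_cvg do rewrite qt; exact: cvg_cst.
    under eq_cvg do rewrite qt.
    apply: cvg_near_cst; near=> n.
    rewrite /m min_l ?subrr// -ler_pdivrMr//.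
    by near: n; exact: nbhs_infty_ger.
apply/esym/eqP; rewrite -subr_eq0 -normr_eq0; apply/eqP/le_anti.
rewrite normr_ge0 andbT leNgt; apply/negP => /q_small[n].
rewrite -(psiq n) ltNge => /negP; apply.
by rewrite (le_trans (contractive_abs _ psi1))// [`|_|]ae_norm_of.
Unshelve. all: by end_near. Qed.

End kothe_functionals.

(** * Transfer from the vector-valued space to the scalar one *)

Section radial.
Context d (S : measurableType d) (R : realType).
Context (mu : {measure set S -> \bar R}).
Hypothesis mu_complete : measure_is_complete mu.
Variables (E : kotheSpace mu) (X : normedModType R).
Local Notation EX := (kothe_bochner_fs mu_complete E X).
Implicit Types (f g h : S -> X) (k : S -> R^o).

Definition pnorm f : S -> R^o := fun t => `|f t|.

Lemma measurable_pnorm f : bochner_measurable mu f ->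
  measurable_fun [set: S] (pnorm f : S -> R).
Proof. exact: bochner_measurable_norm. Qed.

Lemma kb_solid h k : bochner_measurable mu h -> fs_dom E k ->
  (forall t, `|h t| <= `|k t|) -> fs_dom EX h /\ fs_norm EX h <= fs_norm E k.
Proof.
move=> bh Ek hk; have [] := @kothe_solid _ _ _ _ E (pnorm h) k _ Ek.
- exact: measurable_pnorm.
- by move=> t; rewrite normr_id.
- by move=> Eh le; split.
Qed.

(** Where f vanishes the quotient is k t / 0 = 0 by convention, and so is the
    value. *)
Definition radial f k : S -> X := fun t => (k t / `|f t|) *: f t.

Lemma radial_norm_le f k t : `|radial f k t| <= `|k t|.
Proof.
rewrite normrZ normrM normfV normr_id -mulrA ler_piMr//.
by have [->|?] := eqVneq `|f t| 0; [rewrite mulr0|rewrite mulVf].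
Qed.

Lemma radial_solid f k : bochner_measurable mu f -> fs_dom E k ->
  fs_dom EX (radial f k) /\ fs_norm EX (radial f k) <= fs_norm E k.
Proof.
move=> bf Ek; apply: kb_solid => //; last exact: radial_norm_le.
apply: bochner_measurable_scale => //; apply: measurable_funM.
  exact: kothe_measurable Ek.
by apply: measurable_fun_inv_ge0 => //; exact: measurable_pnorm.
Qed.

(** The map k |-> k f/|f| is linear and does not increase norms, so that
    functionals on E(X) pull back to E. *)
Lemma radial_functional f (phi : {linear kothe_bochner mu_complete E X -> R^o}) :
  bochner_measurable mu f -> contractive phi ->
  exists2 psi : {linear kothe_type E -> R^o}, contractive psi &
    forall k, fs_dom E k -> psi (ae_of E k) = phi (ae_of EX (radial f k)).
Proof.
move=> bf phi1.
have dom u : fs_dom EX (radial f (ae_rep (F := E) u)).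
  by have [] := radial_solid bf (ae_rep_dom u).
pose psi0 (u : kothe_type E) : R^o := phi (ae_of EX (radial f (ae_rep u))).
have lin : linear psi0.
  move=> a u v; rewrite /psi0 -linearP; congr (phi _).
  rewrite -[X in _ = X + _]ae_ofZ// -ae_ofD//; last exact: fs_domZ.
  apply: ae_of_eq => //; first by apply: fs_domD => //; exact: fs_domZ.
  apply: filterS2 (ae_repD (a *: u) v) (ae_repZ a u) => t uv au.
  rewrite /radial uv au.
  rewrite -[RHS]/(a *: ((ae_rep u t / `|f t|) *: f t) + (ae_rep v t / `|f t|) *: f t).
  by rewrite scalerA -scalerDl mulrDl mulrA.
pose Lpsi := GRing.isLinear.Build R (kothe_type E) R^o *:%R psi0 lin.
pose psi : {linear kothe_type E -> R^o} := HB.pack psi0 Lpsi.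
exists psi => [u|k Ek].
  rewrite (le_trans (phi1 _))// [leLHS]ae_norm_of//.
  exact: (radial_solid bf (ae_rep_dom u)).2.
congr (phi _); apply: ae_of_eq => //; first exact: (radial_solid bf Ek).1.
by apply: filterS (ae_rep_of Ek) => t; rewrite /radial => ->.
Qed.

End radial.

Section perturbation.
Context d (S : measurableType d) (R : realType).
Context (mu : {measure set S -> \bar R}).
Hypothesis mu_complete : measure_is_complete mu.
Variables (E : kotheSpace mu) (X : normedModType R).
Local Notation EX := (kothe_bochner_fs mu_complete E X).
Implicit Types (f g h z : S -> X).

(** Write q n = |z + n f| - n |f|.  Since phi norms f, applying phi to z + n f gives
    phi z + n ||f|| <= || q n + n |f| || <= ||q n|| + n ||f||, and the q n decrease
    to 0 in E. *)
Lemma vanishing_perturbation f z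
    (phi : {linear kothe_bochner mu_complete E X -> R^o}) :
  order_continuous E -> contractive phi -> fs_dom EX f -> fs_dom EX z ->
  phi (ae_of EX f) = fs_norm EX f ->
  (forall t (n : nat), 0 <= `|z t + n%:R *: f t| - n%:R * `|f t|) ->
  (forall t, (fun n : nat => `|z t + n%:R *: f t| - n%:R * `|f t|) @ \oo
    --> (0 : R)) ->
  phi (ae_of EX z) <= 0.
Proof.
move=> oc phi1 If Iz phif r_ge0 r_cvg.
pose q (n : nat) : S -> R^o := fun t => `|z t + n%:R *: f t| - n%:R * `|f t|.
have Inf n := fs_domZ n%:R If.
have Izf n := fs_domD Iz (Inf n).
have qE n : q n = pnorm (z + n%:R *: f) - n%:R *: pnorm f by [].
have Ef : fs_dom E (pnorm f) := If.2.
have Eq n : fs_dom E (q n).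
  by rewrite qE; apply: fs_domB; [exact: (Izf n).2|exact: fs_domZ].
apply/ler_addgt0Pl => e e0; rewrite addr0.
have [| | |n qn] := order_continuous_seq oc Eq _ _ _ e0.
- by move=> n t; exact: norm_slope_antitone.
- by move=> n t; exact: r_ge0.
- exact: r_cvg.
apply: le_trans (ltW qn).
have := phi1 (ae_of EX (z + n%:R *: f)).
rewrite [`|_|]ae_norm_of// ae_ofD// ae_ofZ// linearD linearZ/= phif.
rewrite -[X in _ + X <= _]/(n%:R * fs_norm EX f) -lerBrDr => /le_trans; apply.
rewrite lerBlDr.
have := fs_normD (Eq n) (fs_domZ n%:R Ef).
by rewrite {1}qE subrK fs_normZ// ger0_norm.
Qed.

End perturbation.

Theorem proposition3p1 (d : measure_display) (S : measurableType d)
    (R : realType) (mu : {measure set S -> \bar R})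
    (mu_complete : measure_is_complete mu)
    (mu_sigma_finite : sigma_finite [set: S] mu)
    (E : kotheSpace mu) (X : completeNormedModType R) :
  order_continuous E ->
  acs (kothe_type E) ->
  acs X ->
  acs (kothe_bochner mu_complete E X).
Proof.
move=> oc acsE acsX U V U1 V1 UV2 phi dphi phiU.
have phi1 := dual_sphere_contractive dphi.
set EX := kothe_bochner_fs mu_complete E X.
pose f : S -> X := ae_rep (U : ae_space EX).
pose g : S -> X := ae_rep (V : ae_space EX).
have If : fs_dom EX f by exact: ae_rep_dom.
have Ig : fs_dom EX g by exact: ae_rep_dom.
have fU : ae_of EX f = U by exact: ae_of_rep.
have gV : ae_of EX g = V by exact: ae_of_rep.
have Ifg := fs_domD If Ig.
pose u := pnorm f; pose v := pnorm g; pose w := pnorm (f + g).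
have Eu : fs_dom E u := If.2.
have Ev : fs_dom E v := Ig.2.
have Ew : fs_dom E w := Ifg.2.
have normE h : fs_dom EX h -> `|ae_of EX h| = fs_norm E (pnorm h).
  by move=> Ih; rewrite ae_norm_of.
have Nu : fs_norm E u = 1 by rewrite -normE// fU.
have Nv : fs_norm E v = 1 by rewrite -normE// gV.
have Nw : fs_norm E w = 2 by rewrite -normE// ae_ofD// fU gV.
have u_ge0 t : 0 <= u t by exact: normr_ge0.
have v_ge0 t : 0 <= v t by exact: normr_ge0.
have [psi psi1 psiE] := radial_functional If.1 phi1.
have psiu : psi (ae_of E u) = 1.
  rewrite psiE// (_ : radial f u = f) ?fU//; apply/funext => t.
  have [ft|ft] := eqVneq (f t) 0; first by rewrite /radial ft scaler0.
  by rewrite /radial divff ?scale1r// normr_eq0.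
have Nu' : `|ae_of E u : kothe_type E| = 1 by rewrite [LHS]ae_norm_of.
have u_neq0 : (ae_of E u : kothe_type E) != 0.
  by rewrite -normr_eq0 Nu' oner_neq0.
have aligned k : fs_dom E k -> 1 + fs_norm E k <= fs_norm E (u + k) ->
    psi (ae_of E k) = fs_norm E k.
  move=> Ek uk; have Euk := fs_domD Eu Ek.
  have Nk : `|ae_of E k : kothe_type E| = fs_norm E k by rewrite [LHS]ae_norm_of.
  rewrite -[RHS]Nk; apply: (acs_aligned acsE _ u_neq0 psi1); last by rewrite Nu'.
  rewrite Nu' Nk -[X in `|X|]ae_ofD// [LHS]ae_norm_of//.
  by apply/le_anti; rewrite uk andbT -Nu; exact: fs_normD.
have EX_le h k : fs_dom EX h -> fs_dom E k ->
    (forall t, `|h t| <= k t) -> fs_norm EX h <= fs_norm E k.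
  move=> Ih Ek hk; have [] := kb_solid mu_complete Ih.1 Ek => // t.
  exact: le_trans (hk t) (ler_norm _).
have psiv : psi (ae_of E v) = 1.
  rewrite aligned// Nv; have <- : fs_norm EX (f + g) = 1 + 1 by exact: Nw.
  by apply: EX_le => // [|t]; [exact: fs_domD|exact: ler_normD].
(* f and f + g are aligned in E(X): the norm of f + (f + g) is 1 + 2. *)
have psiw : psi (ae_of E w) = 2.
  rewrite aligned// Nw.
  have Iffg := fs_domD If Ifg.
  have <- : fs_norm EX (f + (f + g)) = 1 + 2.
    rewrite -[LHS](normE _ Iffg) !ae_ofD// fU gV addrA -mulr2n -scaler_nat -[V]scale1r.
    by rewrite aligned_conic ?U1 ?V1//; lra.
  by apply: EX_le => // [|t]; [exact: fs_domD|exact: ler_normD].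
pose s : S -> R^o := u + v; pose r : S -> R^o := s - w.
have Es : fs_dom E s := fs_domD Eu Ev.
have Er : fs_dom E r := fs_domB Es Ew.
have rE t : r t = u t + v t - w t by [].
have psis : psi (ae_of E s) = fs_norm E s.
  have psis2 : psi (ae_of E s) = 2.
    by rewrite /s ae_ofD// linearD psiu psiv.
  apply/le_anti; rewrite psis2 -{1}Nw.
  rewrite (EX_le (f + g) s Ifg Es)=> [|t]; last exact: ler_normD.
  by have := fs_normD Eu Ev; rewrite Nu Nv.
have psir : psi (ae_of E r) = 0.
  by rewrite /r /s ae_ofB// ae_ofD// linearB linearD/= psiu psiv psiw subrr.
have rs t : 0 <= r t <= s t.
  rewrite rE subr_ge0 gerBl normr_ge0 andbT; exact: ler_normD.
have [] := norming_vanish oc psi1 Es Er Ev psis psir rs v_ge0.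
set v0 := (fun t => _) => Ev0; rewrite psiv psiE// => phiv0.
pose h1 := radial f v0.
have [Ih1 _] := radial_solid mu_complete If.1 Ev0.
(* On G the norm of X is additive at f t and g t, and f t can be normalised. *)
pose G := [set t | r t = 0 /\ f t <> 0].
have mr : measurable_fun [set: S] (r : S -> R) := kothe_measurable Er.
have meas_u : measurable_fun [set: S] (u : S -> R) := kothe_measurable Eu.
have mG : measurable G.
  have -> : G = r @^-1` [set 0] `&` ~` (u @^-1` [set 0]).
    by apply/seteqP; split=> t /= [rt ft]; split=> // h; apply: ft;
      [exact: normr0_eq0|rewrite /u /pnorm h normr0].
  apply: measurableI; last apply: measurableC.
    by rewrite -[X in measurable X]setTI; exact: (mr measurableT [set 0 : R]).
  by rewrite -[X in measurable X]setTI; exact: (meas_u measurableT [set 0 : R]).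
pose h2 : S -> X := fun t => (\1_(~` G) t : R) *: g t.
have h2in t : G t -> h2 t = 0.
  by move=> Gt; rewrite /h2 indicE memNset ?scale0r//=; exact.
have h2out t : ~ G t -> h2 t = g t.
  by move=> Gt; rewrite /h2 indicE mem_set ?scale1r.
have h1in t : G t -> h1 t = (v t / u t) *: f t.
  by move=> [rt ft]; rewrite /h1 /radial /v0 indicE mem_set// mul1r.
have h1out t : ~ G t -> h1 t = 0.
  move=> Gt; have [ft|/eqP ft] := eqVneq (f t) 0.
    by rewrite /h1 /radial ft scaler0.
  rewrite /h1 /radial /v0 indicE memNset ?mul0r ?scale0r//=.
  by move=> rt; apply: Gt.
have [Ih2 _] : fs_dom EX h2 /\ fs_norm EX h2 <= fs_norm E v.
  apply: kb_solid => //.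
    by apply: bochner_measurable_scale Ig.1; exact: measurable_indic (measurableC mG).
  move=> t; rewrite ger0_norm//.
  by have [/h2in ->|/h2out ->] := pselect (G t); rewrite ?normr0.
(* h1 and h2 have disjoint supports and are both dominated by v, so that
   h1 + h2 and h1 - h2 have norm at most 1. *)
have phih2 : phi (ae_of EX h2) = 0.
  have sgn (c : R) : `|c| = 1 -> c * phi (ae_of EX h2) <= 0.
    move=> c1; have Ich2 := fs_domZ c Ih2; have Ih12 := fs_domD Ih1 Ich2.
    have := phi1 (ae_of EX (h1 + c *: h2)).
    rewrite normE// ae_ofD// ae_ofZ// linearD linearZ/= phiv0 => le1.
    have : fs_norm EX (h1 + c *: h2) <= fs_norm E v.
      apply: EX_le => // t; rewrite -[X in `|X|]/(h1 t + c *: h2 t).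
      have [Gt|Gt] := pselect (G t).
        rewrite (h2in _ Gt) scaler0 addr0 (le_trans (radial_norm_le _ _ _))//.
        rewrite /v0 normrM (ger0_norm (v_ge0 t)) ler_piMl// indicE.
        by case: (_ \in _); rewrite ?normr1 ?normr0.
      by rewrite (h1out _ Gt) (h2out _ Gt) add0r normrZ c1 mul1r.
    by rewrite Nv => /(le_trans le1); rewrite gerDl.
  apply/le_anti; have := sgn 1 (normr1 _); rewrite mul1r => ->/=.
  by have := sgn (-1) (normrN1 _); rewrite mulN1r oppr_le0.
(* z is g - (v/u) f on G and 0 elsewhere. *)
pose z := g - h1 - h2.
have Igh1 := fs_domB Ig Ih1; have Iz : fs_dom EX z := fs_domB Igh1 Ih2.
have zE t : z t = g t - h1 t - h2 t by [].
have phiz_le0 (c : R) : c * phi (ae_of EX z) <= 0.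
  have Icz := fs_domZ c Iz.
  suff h t : (forall n : nat, 0 <= `|c *: z t + n%:R *: f t| - n%:R * `|f t|) /\
      (fun n : nat => `|c *: z t + n%:R *: f t| - n%:R * `|f t|) @ \oo --> (0 : R).
    have := @vanishing_perturbation _ _ _ _ mu_complete E X f (c *: z) phi oc phi1
      If Icz.
    rewrite ae_ofZ// linearZ/=; apply.
    - by rewrite fU phiU; exact/esym/Nu.
    - by move=> t; exact: (h t).1.
    - by move=> t; exact: (h t).2.
  have [Gt|Gt] := pselect (G t); last first.
    have -> : z t = 0 by rewrite zE (h1out _ Gt) (h2out _ Gt) subr0 subrr.
    have E0 (n : nat) : `|c *: (0 : X) + n%:R *: f t| - n%:R * `|f t| = 0.
      by rewrite scaler0 add0r normrZ ger0_norm// subrr.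
    split=> [n|]; first by rewrite E0.
    by under eq_cvg do rewrite E0; exact: cvg_cst.
  have -> : z t = g t - (`|g t| / `|f t|) *: f t.
    by rewrite zE (h1in _ Gt) (h2in _ Gt) subr0.
  apply: acs_norm_slope_cvg => //; last exact/eqP/Gt.2.
  by have := Gt.1; rewrite rE => /eqP; rewrite subr_eq0 => /eqP ->.
have phiz : phi (ae_of EX z) = 0.
  apply/le_anti; have := phiz_le0 1; rewrite mul1r => ->/=.
  by have := phiz_le0 (-1); rewrite mulN1r oppr_le0.
have := phiz; rewrite /z !ae_ofB// !linearB/= phih2 phiv0 gV subr0.
by move=> /eqP; rewrite subr_eq0 => /eqP.
Qed.
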